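(* Let $\mathfrak{B}_4:\mathbb{R}^2\to\mathbb{R}^3$ be Bour's minimal surface of value $4$, $$\mathfrak{B}_4(u,v)=\left(\tfrac13u^3-uv^2-\tfrac15u^5+2u^3v^2-uv^4,\; -u^2v+\tfrac13v^3-u^4v+2u^2v^3-\tfrac15v^5,\; \tfrac12u^4-3u^2v^2+\tfrac12v^4\right).$$ Then the class of $\mathfrak{B}_4$ is $cl(\mathfrak{B}_4)=10$.
   Context: For a parametrized surface $\mathbf{x}(u,v)=(x(u,v),y(u,v),z(u,v))$ in $\mathbb{R}^3$ with Gauss map $n=(X(u,v),Y(u,v),Z(u,v))$, write the tangent plane at the parameter $(u,v)$ as the set of points $(x,y,z)$ with $X(u,v)x+Y(u,v)y+Z(u,v)z+P(u,v)=0$, so that $P(u,v)=-\langle n(u,v),\mathbf{x}(u,v)\rangle$. The inhomogeneous tangential coordinates are $\overline{u}=X/P$, $\overline{v}=Y/P$, $\overline{w}=Z/P$ (defined where $P\neq0$). The implicit equation in tangential coordinates is obtained by eliminating $u,v$: it is $g=0$, where $g\in\mathbb{R}[\overline{u},\overline{v},\overline{w}]$ is the irreducible polynomial (unique up to a nonzero constant factor) with $g(\overline{u}(u,v),\overline{v}(u,v),\overline{w}(u,v))=0$ for all $(u,v)$ with $P(u,v)\ne0$. The class $cl$ of the surface is the total degree of $g$. For the surface considered here the Gauss map is $$n=\left(\frac{2u}{u^2+v^2+1},\frac{2v}{u^2+v^2+1},\frac{u^2+v^2-1}{u^2+v^2+1}\right).$$ *)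

(* Defs.v *)
From mathcomp Require Import all_boot all_order all_algebra.
From mathcomp Require Import reals.
From mathcomp Require Import mpoly.

Set Implicit Arguments.
Unset Strict Implicit.
Unset Printing Implicit Defensive.

Import Order.TTheory GRing.Theory Num.Theory.
Local Open Scope ring_scope.

Definition vec3 (R : realType) (a b c : R) : 'rV[R]_3 :=
  \row_j [:: a; b; c]`_j.

Definition dotv (R : realType) (a b : 'rV[R]_3) : R := \sum_j a 0 j * b 0 j.

Definition irreducible_elt (A : idomainType) (p : A) : Prop :=
  [/\ p != 0, p \isn't a GRing.unit &
      forall a b : A, p = a * b -> a \is a GRing.unit \/ b \is a GRing.unit].

(* The library's msize is the total degree plus one, and 0 on the zero
   polynomial. *)
Definition total_degree (R : realType) (k : nat) (g : {mpoly R[k]}) : nat :=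
  (msize g).-1.

Section Tangential.

(* [x] is a parametrized surface and [n] its Gauss map. *)
Variables (R : realType) (x n : R -> R -> 'rV[R]_3).

(* The tangent plane at (u, v) is the set of p with
   dotv (n u v) p + tangent_offset u v = 0. *)
Definition tangent_offset (u v : R) : R := - dotv (n u v) (x u v).

(* (X/P, Y/P, Z/P); meaningful only where P = tangent_offset u v is nonzero. *)
Definition tangential_coords (u v : R) : 'rV[R]_3 :=
  \row_j (n u v 0 j / tangent_offset u v).

Definition tangential_equation (g : {mpoly R[3]}) : Prop :=
  irreducible_elt g /\
  forall u v : R, tangent_offset u v != 0 ->
    g.@[fun j => tangential_coords u v 0 j] = 0.

(* The class is stated as a relation: it is the total degree of _the_
   irreducible tangential equation, so existence and uniqueness up to a nonzero
   constant are both part of having a class. *)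
Definition has_class (d : nat) : Prop :=
  exists g : {mpoly R[3]},
    [/\ tangential_equation g,
        forall h : {mpoly R[3]}, tangential_equation h ->
          exists2 c : R, c != 0 & h = c *: g &
        total_degree g = d].

End Tangential.

Definition bour4 (R : realType) (u v : R) : 'rV[R]_3 :=
  vec3
    (1 / 3 * u ^+ 3 - u * v ^+ 2 - 1 / 5 * u ^+ 5
       + 2 * u ^+ 3 * v ^+ 2 - u * v ^+ 4)
    (- (u ^+ 2 * v) + 1 / 3 * v ^+ 3 - u ^+ 4 * v
       + 2 * u ^+ 2 * v ^+ 3 - 1 / 5 * v ^+ 5)
    (1 / 2 * u ^+ 4 - 3 * u ^+ 2 * v ^+ 2 + 1 / 2 * v ^+ 4).

Definition bour4_gauss (R : realType) (u v : R) : 'rV[R]_3 :=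
  vec3
    (2 * u / (u ^+ 2 + v ^+ 2 + 1))
    (2 * v / (u ^+ 2 + v ^+ 2 + 1))
    ((u ^+ 2 + v ^+ 2 - 1) / (u ^+ 2 + v ^+ 2 + 1)).

(* Main.v *)
Require Import Defs.
From mathcomp Require Import all_boot all_order all_algebra.
From mathcomp Require Import reals.
From mathcomp Require Import mpoly.
From mathcomp Require Import ring lra zify.
Import Order.TTheory GRing.Theory Num.Theory.

(** Put [s = u^2 + v^2] and [A(u,v) = Re (u + i v)^4].  The tangential coordinates
    of the surface are [(a, b, c) = q (u, v, (s - 1) / 2)] with
    [q = - 60 / (A(u,v) (5 + 3 s))], and eliminating [q] gives a polynomial [G] of
    total degree 10, whose degree in [c] is 5, with leading coefficient
    [1440 A(a,b)].  The polynomials vanishing on the surface form a prime ideal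
    [V], and it suffices to show that [V = (G)].

    Pseudo-dividing [h] in [V] by [G] with respect to [c] gives
    [(1440 A(a,b))^n h = Q G + r].  No nonzero [r] of degree at most 4 in [c] is in
    [V]: one of minimal degree would divide [G] up to a factor in [a, b], whereas
    [G] is reverse-Eisenstein at each linear factor [b - k a] of [A(a,b)], and
    nonzero polynomials in [a, b] are not in [V] because [(a, b)] covers the set
    [A <> 0].  Finally [A(a,b)] splits into linear factors over the reals, and
    none of them divides [G], so that they all cancel. *)

(** * Reduction modulo a linear polynomial in the coefficients, and an Eisenstein criterion *)

Lemma polyscaleI {A : idomainType} {c : A} :
  (c != 0)%R -> injective (fun p : {poly A} => c *: p)%R.
Proof.
move=> c0 p q; rewrite -!mul_polyC; apply: mulfI.
by rewrite polyC_eq0.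
Qed.

Section LinearPrime.
Local Open Scope ring_scope.
Context {B : idomainType} (k : B).
Implicit Types (f g G Q r : {poly {poly B}}) (w M : {poly B}).

Local Notation ell := ('X - k%:P : {poly B}).
Local Notation red := (map_poly (horner_eval k)).

Lemma red_eq0_dvd f : red f = 0 -> exists g, f = ell *: g.
Proof.
elim/poly_ind: f => [|f c IHf] f0; first by exists 0; rewrite scaler0.
have c0 : c.[k] = 0.
  have := congr1 (fun p : {poly B} => p`_0) f0.
  by rewrite coef_map /= coefD coefMX coefC eqxx add0r coef0.
have [|g fE] := IHf.
  apply/polyP => i; have := congr1 (fun p : {poly B} => p`_i.+1) f0.
  by rewrite !coef_map /= coefD coefMX coefC addr0 !coef0.
have /factor_theorem [d cE] : root c k by apply/rootP.
exists (g * 'X + d%:P).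
by rewrite fE cE scalerDr scalerAl -!mul_polyC -polyCM [d * _]mulrC.
Qed.

Lemma red_scale_ell f : red (ell *: f) = 0.
Proof.
apply/polyP => i.
by rewrite coef_map coefZ coef0 /= /horner_eval hornerM hornerXsubC subrr mul0r.
Qed.

Lemma ell_neq0 : ell != 0. Proof. by rewrite polyXsubC_eq0. Qed.

(** As [red] is a ring morphism into a domain, ['X - k] is prime: dividing [Q * G] but not [G], it
    divides [Q]. Its powers thus cancel one at a time. *)
Lemma cancel_linear_exp n f Q G : ell ^+ n *: f = Q * G -> red G != 0 ->
  exists Q', f = Q' * G.
Proof.
move=> eq_fG G0; elim: n Q eq_fG => [|n IHn] Q eq_fG.
  by exists Q; rewrite -eq_fG expr0 scale1r.
have /eqP : red (Q * G) = 0 by rewrite -eq_fG exprS -scalerA red_scale_ell.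
rewrite rmorphM mulf_eq0 (negPf G0) orbF => /eqP/red_eq0_dvd[Q' QE].
apply: (IHn Q'); apply: (polyscaleI ell_neq0).
by rewrite scalerA -exprS eq_fG QE scalerAl.
Qed.

(** Both reductions divide a nonzero constant, hence are constant, so a non-constant [f] loses its
    leading coefficient under [red]. *)
Lemma lead_coef_red f g (c : B) : c%:P = red f * red g -> c != 0 -> (1 < size f)%N ->
  (lead_coef f).[k] = 0.
Proof.
move=> cE c0 sf.
have fg0 : red f * red g != 0 by rewrite -cE polyC_eq0.
have : size (red f) == 1%N.
  have := congr1 (fun p : {poly B} => size p) cE.
  move: fg0; rewrite mulf_eq0 negb_or => /andP[f0 g0].
  rewrite size_mul // size_polyC c0.
  move: f0 g0; rewrite -!size_poly_gt0.
  by case: (size _) => [|[|?]] //; case: (size _) => [|[|?]] // _ _; rewrite !addSn !addnS.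
move=> /eqP sf1; rewrite /lead_coef -[X in X = _]/(horner_eval k _) -coef_map /=.
by rewrite nth_default // sf1 -subn1 subn_gt0.
Qed.

(* Eisenstein's criterion for the reciprocal polynomial: here the leading
   coefficient is exactly divisible by ['X - k] and all the other ones, except
   the constant one, are divisible by it. *)
Lemma eisenstein_linear G Q r w M (c : B) :
  red G = c%:P -> c != 0 -> lead_coef G = ell * M -> M.[k] != 0 ->
  w != 0 -> w *: G = Q * r -> (size Q <= 1)%N || (size r <= 1)%N.
Proof.
move=> redG c0 lcG Mk; elim: {w}(size w) {-2}w (leqnn (size w)) Q r => [|n IHn] w.
  by rewrite leqn0 size_poly_eq0 => ->.
move=> sw Q r w0 eqG; have [wk|wk] := eqVneq w.[k] 0.
  have /factor_theorem [d wE] : root w k by apply/rootP.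
  have d0 : d != 0 by apply: contraNneq w0 => d0; rewrite wE d0 mul0r.
  have sd : (size d <= n)%N by move: sw; rewrite wE size_Mmonic ?monicXsubC // size_XsubC addn2.
  have eqG' : ell *: (d *: G) = Q * r by rewrite -eqG wE scalerA mulrC.
  have /eqP : red (Q * r) = 0 by rewrite -eqG' red_scale_ell.
  rewrite rmorphM mulf_eq0 => /orP[] /eqP/red_eq0_dvd[g gE].
    have sg : size Q = size g by rewrite gE size_scale // ell_neq0.
    rewrite sg; apply: (IHn d) => //.
    by apply: (polyscaleI ell_neq0); rewrite eqG' gE scalerAl.
  have sg : size r = size g by rewrite gE size_scale // ell_neq0.
  rewrite sg; apply: (IHn d) => //.
  by apply: (polyscaleI ell_neq0); rewrite eqG' gE scalerAr.
(* Here ['X - k] does not divide [w]. If neither factor is constant, it divides both leading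
   coefficients, so its square divides [w * (ell * M)], against [M.[k] != 0]. *)
case: leqP => //= sQ; case: leqP => //= sr.
have redE : (w.[k] * c)%:P = red Q * red r.
  by rewrite -rmorphM -eqG /= map_polyZ redG /= -mul_polyC -polyCM.
have wc0 : w.[k] * c != 0 by rewrite mulf_neq0.
have /factor_theorem [q qE] : root (lead_coef Q) k.
  by apply/rootP; apply: lead_coef_red redE wc0 sQ.
have /factor_theorem [t tE] : root (lead_coef r) k.
  by apply/rootP; apply: (lead_coef_red r Q) wc0 _ => //; rewrite redE mulrC.
have := congr1 lead_coef eqG; rewrite lead_coefZ lead_coefM lcG qE tE.
rewrite mulrCA [X in _ = X](_ : _ = ell * (q * t * ell)); last by ring.
move/(mulfI ell_neq0)/(congr1 (horner_eval k)); rewrite /horner_eval !hornerM.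
by rewrite hornerXsubC subrr mulr0 => /eqP; rewrite mulf_eq0 (negPf wk) (negPf Mk).
Qed.

End LinearPrime.

(** * The class polynomial over an arbitrary commutative ring *)

Section ClassPolynomial.
Local Open Scope ring_scope.
Context {S : comNzRingType}.
Implicit Types a b c : S.

(** The general ring [S] lets the same formulas serve for points, nested polynomials and [{mpoly
    R[3]}]. *)
Definition quartic a b : S := a ^+ 4 - 6 * a ^+ 2 * b ^+ 2 + b ^+ 4.

Definition class_poly a b c : S :=
  900 * (a ^+ 2 + b ^+ 2) ^+ 4
  + quartic a b * (1440 * c ^+ 5 + 2400 * (a ^+ 2 + b ^+ 2) * c ^+ 3
                   + 900 * (a ^+ 2 + b ^+ 2) ^+ 2 * c)
  - quartic a b ^+ 2 * (16 * (a ^+ 2 + b ^+ 2) + 15 * c ^+ 2).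

(* The coordinate [q] is a root of [q^2 + 2 c q - (a^2 + b^2)], and [class_poly]
   is the norm of [30 q^4 + quartic a b * (4 q + 3 c)] over this quadratic. *)
Lemma class_poly_param (q u v w : S) :
  u ^+ 2 + v ^+ 2 = 2 * w + 1 -> q * quartic u v * (4 + 3 * w) = - 30 ->
  class_poly (q * u) (q * v) (q * w) = 0.
Proof.
move=> wE qE.
have rE : (q * u) ^+ 2 + (q * v) ^+ 2 = q ^+ 2 * (2 * w + 1).
  by rewrite -wE; ring.
have CE : quartic (q * u) (q * v) = q ^+ 3 * (q * quartic u v).
  by rewrite /quartic; ring.
rewrite /class_poly rE CE; move: (q * quartic u v) qE => e eE.
(* Up to [q ^+ 4] each, the two factors of the norm are its values at [q], which is zero, and at the
   conjugate root [- q * (2 * w + 1)]. *)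
transitivity (q ^+ 8 * (30 + e * (4 + 3 * w)) *
              (30 * (2 * w + 1) ^+ 4 - e * (4 + 5 * w))); first by ring.
by rewrite eE subrr mulr0 mul0r.
Qed.

End ClassPolynomial.

Lemma rmorph_quartic {S T : comNzRingType} (f : {rmorphism S -> T}) a b :
  f (quartic a b) = quartic (f a) (f b).
Proof. by rewrite /quartic; ring. Qed.

Lemma rmorph_class_poly {S T : comNzRingType} (f : {rmorphism S -> T}) a b c :
  f (class_poly a b c) = class_poly (f a) (f b) (f c).
Proof. by rewrite /class_poly /quartic; ring. Qed.

(** * The prime ideal of polynomials vanishing on the surface *)

Section Vanishing.
Local Open Scope ring_scope.

Lemma natr_roots_poly_eq0 {A : idomainType} (p : {poly A}) :
  [pchar A] =i pred0 -> (forall n : nat, p.[n%:R] = 0) -> p = 0.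
Proof.
move=> ch p0; apply: (@roots_geq_poly_eq0 _ p (map (fun n => n%:R) (iota 0 (size p)))).
- by apply/allP => _ /mapP[n _ ->]; apply/rootP.
- rewrite map_inj_uniq ?iota_uniq // => m n.
  wlog lemn : m n / (m <= n)%N.
    by move=> H; case/orP: (leq_total m n) => [/H//|/H H' /esym/H'].
  move/esym/eqP; rewrite -subr_eq0 -natrB // ((pcharf0P _).1 ch) subn_eq0 => nm.
  by apply/eqP; rewrite eqn_leq lemn.
- by rewrite size_map size_iota.
Qed.

Context {R : realType}.
Implicit Types (u v x y a b c : R) (f g : {poly {poly {poly R}}}).

Lemma horner2_eq0 (p : {poly {poly R}}) :
  (forall x y, p.[y%:P].[x] = 0) -> p = 0.
Proof.
move=> p0; apply: natr_roots_poly_eq0 => [i|n].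
  by rewrite pchar_poly; apply: pchar_num.
apply: natr_roots_poly_eq0 => [|m]; first exact: pchar_num.
by rewrite -polyC_natr p0.
Qed.

Lemma horner2_quartic x y :
  (quartic 'X%:P 'X : {poly {poly R}}).[y%:P].[x] = quartic x y.
Proof.
rewrite -[LHS]/(horner_eval x (horner_eval y%:P _)) !rmorph_quartic.
by rewrite /= /horner_eval !hornerC hornerX hornerX hornerC.
Qed.

Lemma quarticX_neq0 : (quartic 'X%:P 'X : {poly {poly R}}) != 0.
Proof.
apply/eqP => C0; have := horner2_quartic 1 0; rewrite C0 !horner0 /quartic.
by lra.
Qed.

Lemma exists_quintic_root (s k : R) :
  0 <= s -> exists l : R, 3 * s * l ^+ 5 + 5 * l ^+ 3 = k.
Proof.
move=> s0; pose p : {poly R} := (3 * s) *: 'X^5 + 5 *: 'X^3 - k%:P.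
have pE x : p.[x] = 3 * s * x ^+ 5 + 5 * x ^+ 3 - k by rewrite !hornerE.
have bound (M : R) : 1 <= M -> 0 <= 3 * s * M ^+ 5 /\ M <= 5 * M ^+ 3.
  move=> M1; have M0 : 0 <= M by lra.
  split; first by rewrite !mulr_ge0 // exprn_ge0.
  by have : M ^+ 3 >= M by [rewrite -{1}(expr1 M) ler_weXn2l]; lra.
have [||x _ /rootP px] := @poly_ivt _ p (- (1 + `|k|)) (1 + `|k|).
- by have := normr_ge0 k; lra.
- have [|b1 b2] := bound (1 + `|k|); first by have := normr_ge0 k; lra.
  rewrite !pE; apply/andP; split; last by have := ler_norm k; lra.
  have := ler_norm (- k); rewrite normrN => kn.
  move: b1 b2; set M := 1 + _ => b1 b2.
  have -> : 3 * s * (- M) ^+ 5 + 5 * (- M) ^+ 3 - k =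
    - (3 * s * M ^+ 5) - 5 * M ^+ 3 - k by ring.
  by rewrite /M in b1 b2 *; lra.
by exists x; move: px; rewrite pE => /subr0_eq.
Qed.

(* The variables [a], [b], [c] are, in this order, the innermost, the middle and the
   outermost indeterminate. *)
Definition eval3 f a b c : R := f.[c%:P%:P].[b%:P].[a].

(** Up to the factor [- 1 / (30 * (u ^+ 2 + v ^+ 2 + 1))], this is the offset of the tangent
    plane. *)
Definition denom u v : R := quartic u v * (5 + 3 * (u ^+ 2 + v ^+ 2)).

Definition vanishes f : Prop := forall u v, denom u v != 0 ->
  let q := - 60 / denom u v in
  eval3 f (q * u) (q * v) (q * ((u ^+ 2 + v ^+ 2 - 1) / 2)) = 0.

(** With [s = 2 * w + 1], the factor [5 + 3 * s] of [denom] is [2 * (4 + 3 * w)]. *)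
Lemma class_poly_coords u v : denom u v != 0 ->
  let q := - 60 / denom u v in
  class_poly (q * u) (q * v) (q * ((u ^+ 2 + v ^+ 2 - 1) / 2)) = 0.
Proof.
move=> d0 q; apply: class_poly_param; first by field.
have : q * denom u v = - 60 by rewrite /q divfK.
by rewrite /denom mulrA => qd; lra.
Qed.

Lemma eval3D f g a b c : eval3 (f + g) a b c = eval3 f a b c + eval3 g a b c.
Proof. by rewrite /eval3 !hornerE. Qed.

Lemma eval3M f g a b c : eval3 (f * g) a b c = eval3 f a b c * eval3 g a b c.
Proof. by rewrite /eval3 !hornerE. Qed.

Lemma vanishes_const (p : {poly {poly R}}) : vanishes p%:P -> p = 0.
Proof.
move=> vp.
(* The extra factor disposes of the points where [quartic] is zero. *)
suff /eqP : (quartic 'X%:P 'X : {poly {poly R}}) * p = 0.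
  by rewrite mulf_eq0 (negPf quarticX_neq0) => /eqP.
apply: horner2_eq0 => x y.
rewrite !hornerM.
rewrite horner2_quartic.
have [->|C0] := eqVneq (quartic x y) 0; first by rewrite mul0r.
have s0 : 0 <= x ^+ 2 + y ^+ 2 by rewrite addr_ge0 ?sqr_ge0.
(* The point with parameters [l * x] and [l * y] has first coordinates [x] and
   [y]. *)
have [l lE] := exists_quintic_root _ (- 60 / quartic x y) s0.
have l0 : l != 0.
  apply: contra_eq_neq lE => ->; rewrite !expr0n /= !mulr0 addr0 eq_sym.
  by rewrite mulf_neq0 ?invr_eq0 // oppr_eq0 pnatr_eq0.
(* The quintic equation for [l] was chosen to give this value, which makes [q] equal to [l^-1]. *)
have dE : denom (l * x) (l * y) = - 60 * l.
  have -> : - 60 = quartic x y * (3 * (x ^+ 2 + y ^+ 2) * l ^+ 5 + 5 * l ^+ 3).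
    by rewrite lE; field.
  by rewrite /denom /quartic; ring.
have d0 : denom (l * x) (l * y) != 0.
  by rewrite dE mulf_neq0 // oppr_eq0 pnatr_eq0.
have := vp _ _ d0; rewrite /eval3 /= hornerC dE => pz.
rewrite (_ : p.[y%:P].[x] = 0) ?mulr0 // -[RHS]pz.
by do 2?congr horner; rewrite ?mulrA; try congr polyC; field; rewrite l0 ?oppr_eq0 ?pnatr_eq0.
Qed.

(** Membership in the ring of polynomials in [u], [v] localized at [denom], expressed by a numerator
    in the domain [{poly {poly R}}]. *)
Definition regular (F : R -> R -> R) : Prop :=
  exists n (H : {poly {poly R}}),
    forall u v, denom u v != 0 -> H.[v%:P].[u] = denom u v ^+ n * F u v.

Definition denom_poly : {poly {poly R}} :=
  quartic 'X%:P 'X * (5 + 3 * ('X%:P ^+ 2 + 'X ^+ 2)).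

Lemma horner2_denom_poly u v : denom_poly.[v%:P].[u] = denom u v.
Proof. by rewrite hornerM hornerM horner2_quartic -!polyC_natr !hornerE. Qed.

Lemma denom_poly_neq0 : denom_poly != 0.
Proof.
apply/eqP => d0; have := horner2_denom_poly 1 0; rewrite d0 !horner0.
by rewrite /denom /quartic; lra.
Qed.

Lemma eq_regular {F G} : F =2 G -> regular F -> regular G.
Proof. by move=> FG [n [H HE]]; exists n, H => u v /HE; rewrite FG. Qed.

Lemma regularD {F G} : regular F -> regular G ->
  regular (fun u v => F u v + G u v).
Proof.
move=> [n [H HE]] [m [K KE]]; exists (n + m)%N.
exists (denom_poly ^+ m * H + denom_poly ^+ n * K) => u v d0.
move: denom_poly horner2_denom_poly => d dE.
rewrite !(hornerD, hornerM, horner_exp) dE HE // KE //.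
by rewrite mulrDr exprD; ring.
Qed.

Lemma regularM {F G} : regular F -> regular G ->
  regular (fun u v => F u v * G u v).
Proof.
move=> [n [H HE]] [m [K KE]]; exists (n + m)%N, (H * K) => u v d0.
by rewrite hornerM hornerM HE // KE // mulrACA exprD.
Qed.

Lemma regular_cst c : regular (fun _ _ => c).
Proof. by exists 0%N, c%:P%:P => u v _; rewrite !hornerC mul1r. Qed.

Lemma regular_num (H : {poly {poly R}}) :
  regular (fun u v => - 60 / denom u v * H.[v%:P].[u]).
Proof.
exists 1%N, ((- 60)%:P%:P * H) => u v d0.
by rewrite hornerM hornerM !hornerC mulrA expr1 mulrCA divff // mulr1.
Qed.

(** The three coordinates are regular, and sums and products preserve this; each layer of the nested
    polynomial takes one induction. *)
Lemma regular_eval3 f : regular (fun u v =>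
  let q := - 60 / denom u v in
  eval3 f (q * u) (q * v) (q * ((u ^+ 2 + v ^+ 2 - 1) / 2))).
Proof.
have reg_a : regular (fun u v => - 60 / denom u v * u).
  by apply: eq_regular (regular_num 'X%:P) => u v; rewrite !hornerE.
have reg_b : regular (fun u v => - 60 / denom u v * v).
  by apply: eq_regular (regular_num 'X) => u v; rewrite !hornerE.
have reg_c : regular
    (fun u v => - 60 / denom u v * ((u ^+ 2 + v ^+ 2 - 1) / 2)).
  apply: eq_regular (regular_num (('X%:P ^+ 2 + 'X ^+ 2 - 1) * 2^-1%:P%:P)) => u v.
  by rewrite !hornerE.
elim/poly_ind: f => [|f c IHf].
  by apply: eq_regular (regular_cst 0) => u v; rewrite /eval3 !horner0.
pose fb u v := - 60 / denom u v * v.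
suff reg0 : regular (fun u v => c.[(fb u v)%:P].[- 60 / denom u v * u]).
  apply: eq_regular (regularD (regularM IHf reg_c) reg0) => u v.
  by rewrite /eval3 /fb !hornerE.
elim/poly_ind: c => [|c d IHc].
  by apply: eq_regular (regular_cst 0) => u v; rewrite !horner0.
suff reg0 : regular (fun u v => d.[- 60 / denom u v * u]).
  apply: eq_regular (regularD (regularM IHc reg_b) reg0) => u v.
  by rewrite !hornerE.
elim/poly_ind: d => [|d e IHd].
  by apply: eq_regular (regular_cst 0) => u v; rewrite !horner0.
apply: eq_regular (regularD (regularM IHd reg_a) (regular_cst e)) => u v.
by rewrite !hornerE.
Qed.

(** The numerators of [f] and [g] have a product that vanishes off the zeros of [denom]. Multiplied
    by [denom] it vanishes everywhere, and [{poly {poly R}}] is a domain. *)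
Lemma vanishes_prime f g : vanishes (f * g) -> vanishes f \/ vanishes g.
Proof.
move=> vfg.
have [n [F FE]] := regular_eval3 f; have [m [G GE]] := regular_eval3 g.
have : denom_poly * (F * G) = 0.
  apply: horner2_eq0 => u v.
  rewrite hornerM hornerM horner2_denom_poly.
  have [->|d0] := eqVneq (denom u v) 0; first by rewrite mul0r.
  have := vfg _ _ d0.
  rewrite hornerM hornerM FE // GE //= => vfg0.
  by rewrite [X in _ * X]mulrACA -eval3M vfg0 !mulr0.
move/eqP; rewrite mulf_eq0 (negPf denom_poly_neq0) mulf_eq0 /=.
move=> /orP[] /eqP H0; [left|right] => u v d0 /=; apply/eqP.
- have /eqP := FE _ _ d0; rewrite H0 !horner0 eq_sym mulf_eq0 => /orP[|//].
  by rewrite expf_eq0 (negPf d0) andbF.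
- have /eqP := GE _ _ d0; rewrite H0 !horner0 eq_sym mulf_eq0 => /orP[|//].
  by rewrite expf_eq0 (negPf d0) andbF.
Qed.

End Vanishing.

(** * The class polynomial generates the vanishing ideal *)

Section ClassPolynomialIdeal.
Local Open Scope ring_scope.
Context {R : realType}.
Implicit Types (f g h r Q : {poly {poly {poly R}}}).

Local Notation quarticXY := (quartic 'X%:P 'X : {poly {poly R}}).
Local Notation rhoXY := ('X%:P ^+ 2 + 'X ^+ 2 : {poly {poly R}}).

Definition class_poly3 : {poly {poly {poly R}}} :=
  class_poly 'X%:P%:P 'X%:P 'X.

Lemma class_poly3E : class_poly3 =
  Poly [:: 900 * rhoXY ^+ 4 - 16 * quarticXY ^+ 2 * rhoXY;
           900 * quarticXY * rhoXY ^+ 2; - 15 * quarticXY ^+ 2;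
           2400 * quarticXY * rhoXY; 0; 1440 * quarticXY].
Proof.
rewrite /= !cons_poly_def /class_poly3 /class_poly /quartic.
by ring.
Qed.

Lemma polynatr_neq0 n : (n.+1%:R : {poly {poly R}}) != 0.
Proof. by rewrite -!polyC_natr !polyC_eq0 pnatr_eq0. Qed.

Lemma size_class_poly3 : size class_poly3 = 6%N.
Proof.
by rewrite class_poly3E (@PolyK _ 0) //= mulf_neq0 ?quarticX_neq0 // polynatr_neq0.
Qed.

Lemma lead_coef_class_poly3 : lead_coef class_poly3 = 1440 * quarticXY.
Proof.
rewrite lead_coefE size_class_poly3 class_poly3E (@PolyK _ 0) //=.
by rewrite mulf_neq0 ?quarticX_neq0 // polynatr_neq0.
Qed.

Lemma vanishes_class_poly3 : vanishes class_poly3.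
Proof.
move=> u v d0 /=.
have -> a b c : eval3 class_poly3 a b c = class_poly a b c.
  rewrite -[LHS]/(horner_eval a (horner_eval b%:P (horner_eval c%:P%:P _))).
  rewrite /class_poly3 !rmorph_class_poly /= /horner_eval.
  by rewrite !(hornerC, hornerX).
exact: class_poly_coords.
Qed.

Lemma vanishesMl g f : vanishes f -> vanishes (g * f).
Proof. by move=> vf u v d0 /=; rewrite eval3M (vf u v d0) mulr0. Qed.

Lemma vanishesB f g : vanishes f -> vanishes g -> vanishes (f - g).
Proof.
move=> vf vg u v d0 /=; have /= := vanishesMl (-1) g vg u v d0.
by rewrite mulN1r eval3D => ->; rewrite addr0; apply: vf.
Qed.

(** The remainder of a pseudo-division is still a combination of [f] and [g]. *)
Lemma vanishes_modp f g : vanishes f -> vanishes g -> vanishes (f %% g).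
Proof.
move=> vf vg.
rewrite (_ : f %% g = (lead_coef g ^+ scalp f g)%:P * f - f %/ g * g).
  by apply: vanishesB; apply: vanishesMl.
by rewrite mul_polyC Pdiv.Idomain.divp_eq addrC addKr.
Qed.

Lemma slope_neq0 (k : R) : quartic 1 k = 0 -> k != 0.
Proof. by move=> kE; apply/eqP => k0; move: kE; rewrite k0 /quartic; lra. Qed.

Section Slope.
Variable k : R.
Hypothesis kE : quartic 1 k = 0.
Local Notation kX := (k *: 'X : {poly R}).
Local Notation red := (map_poly (horner_eval kX)).

(** On the line [b = k a] the quartic is zero, so only the first term of [class_poly] survives. *)
Lemma red_class_poly3 : red class_poly3 = (900 * ('X ^+ 2 + kX ^+ 2) ^+ 4)%:P.
Proof.
rewrite /class_poly3 rmorph_class_poly /= map_polyX !map_polyC /= /horner_eval.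
rewrite hornerC hornerX /class_poly -!rmorph_quartic /=.
have -> : quartic 'X kX = 0.
  transitivity (quartic 1 k *: 'X ^+ 4 : {poly R}); last by rewrite kE scale0r.
  by rewrite /quartic -!mul_polyC; ring.
by rewrite -!mul_polyC; ring.
Qed.

Lemma red_class_poly3_neq0 : 900 * ('X ^+ 2 + kX ^+ 2) ^+ 4 != 0 :> {poly R}.
Proof.
rewrite mulf_neq0 ?expf_neq0 //; first by rewrite -polyC_natr polyC_eq0 pnatr_eq0.
rewrite exprZn -[X in X + _]scale1r -scalerDl scaler_eq0 negb_or.
rewrite expf_neq0 ?polyX_eq0 // andbT.
by apply: lt0r_neq0; rewrite ltr_pwDl // sqr_ge0.
Qed.

Definition cofactor_quartic : {poly {poly R}} :=
  ('X + kX%:P) * ('X ^+ 2 - ((6 - k ^+ 2) *: 'X ^+ 2)%:P).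

Lemma quartic_slope_factor : quarticXY = ('X - kX%:P) * cofactor_quartic.
Proof.
apply/subr0_eq; transitivity ((quartic 1 k)%:P%:P * 'X%:P ^+ 4 : {poly {poly R}}).
  by rewrite /cofactor_quartic /quartic -!mul_polyC; ring.
by rewrite kE mul0r.
Qed.

(** The slope [k] is a simple root: the derivative there is [4 k (k^2 - 3)], and [k^2 = 3] would
    give [quartic 1 k] the value [-8]. *)
Lemma cofactor_quartic_neq0 : cofactor_quartic.[kX] != 0.
Proof.
rewrite (_ : cofactor_quartic.[kX] = (4 * k * (k ^+ 2 - 3)) *: 'X ^+ 3); last first.
  by rewrite /cofactor_quartic !hornerE -!mul_polyC; ring.
rewrite scaler_eq0 negb_or expf_neq0 ?polyX_eq0 // andbT.
rewrite !mulf_neq0 ?pnatr_eq0 //.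
  exact: slope_neq0.
apply/eqP => k2; move: kE; rewrite /quartic.
rewrite (_ : k ^+ 4 = (k ^+ 2 - 3) ^+ 2 + 6 * (k ^+ 2 - 3) + 9); last by ring.
by rewrite k2 (subr0_eq k2); lra.
Qed.

Lemma vanishes_size_lt r : vanishes r -> (size r < 6)%N -> r = 0.
Proof.
elim/ltn_ind: {r}(size r) {-2}r (erefl (size r)) => n IHn r rE vr rn.
apply/eqP; apply: contraT => r0.
have [r1|r1] := leqP n 1.
  move: (vr) r0; rewrite (size1_polyC (p := r)) ?rE // => /vanishes_const ->.
  by rewrite eqxx.
(* This remainder vanishes on the surface and is shorter than [r], so the induction hypothesis
   applies. *)
have mod0 : class_poly3 %% r = 0.
  apply: (IHn _ _ _ erefl).
  - by rewrite -rE ltn_modp.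
  - exact/vanishes_modp/vr/vanishes_class_poly3.
  - by apply: ltn_trans rn; rewrite ltn_modp.
have := Pdiv.Idomain.divp_eq class_poly3 r; rewrite mod0 addr0 => eqG.
have w0 : lead_coef r ^+ scalp class_poly3 r != 0.
  by rewrite expf_neq0 // lead_coef_eq0.
have lcE : lead_coef class_poly3 = ('X - kX%:P) * (1440 * cofactor_quartic).
  by rewrite lead_coef_class_poly3 quartic_slope_factor mulrCA.
have M0 : (1440 * cofactor_quartic).[kX] != 0.
  rewrite hornerM mulf_neq0 ?cofactor_quartic_neq0 //.
  by rewrite -polyC_natr hornerC -polyC_natr polyC_eq0 pnatr_eq0.
have := eisenstein_linear _ _ _ _ _ _ _ red_class_poly3 red_class_poly3_neq0 lcE M0 w0 eqG.
rewrite rE [(n <= 1)%N]leqNgt r1 orbF => sQ.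
have := congr1 (fun p : {poly {poly {poly R}}} => size p) eqG.
rewrite size_scale // size_class_poly3 => sE.
(* With a quotient constant in [c], [r] would have size at least 6. *)
have := size_polyMleq (class_poly3 %/ r) r; rewrite -sE rE => s6.
by move: (size _) sQ s6 rn => m; lia.
Qed.

End Slope.

Lemma exists_slope : exists k : R, quartic 1 k = 0.
Proof.
(* This is the tangent of pi/8, for which the fourth power of [1 + i k] is purely imaginary. *)
exists (Num.sqrt 2 - 1); rewrite /quartic.
have : Num.sqrt 2 ^+ 2 = 2 :> R by rewrite sqr_sqrtr.
move: (Num.sqrt 2) => s s2; transitivity ((s ^+ 2 - 2) * (s ^+ 2 - 4 * s + 2)); first by ring.
by rewrite s2 subrr mul0r.
Qed.

(** The quartic is even and palindromic in the slope, so one root gives all four. *)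
Lemma quarticXY_slopes (k : R) : quartic 1 k = 0 ->
  quarticXY = ('X - (k *: 'X)%:P) * ('X - ((- k) *: 'X)%:P)
     * ('X - (k^-1 *: 'X)%:P) * ('X - ((- k^-1) *: 'X)%:P).
Proof.
move=> kE.
have k0 : k != 0 by apply: slope_neq0.
have k2 : k ^- 2 = 6 - k ^+ 2.
  apply: (mulfI (expf_neq0 2 k0)); rewrite mulfV ?expf_neq0 //.
  by apply/eqP; rewrite -subr_eq0 -kE /quartic; apply/eqP; ring.
rewrite (quartic_slope_factor k) // /cofactor_quartic -k2.
have -> : k ^- 2 = k^-1 ^+ 2 by rewrite exprVn.
by rewrite -!mul_polyC; ring.
Qed.

Lemma vanishes_dvd h : vanishes h -> exists Q, h = Q * class_poly3.
Proof.
move=> vh; have [k kE] := exists_slope.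
have k0 : k != 0 by apply: slope_neq0.
have kNE : quartic 1 (- k) = 0 by rewrite -kE /quartic; ring.
have kVE : quartic 1 k^-1 = 0.
  by apply: (mulfI (expf_neq0 4 k0)); rewrite mulr0 -kE /quartic; field.
have kNVE : quartic 1 (- k^-1) = 0 by rewrite -kVE /quartic; ring.
have G0 : class_poly3 != 0 by rewrite -size_poly_eq0 size_class_poly3.
have mod0 : h %% class_poly3 = 0.
  apply: (vanishes_size_lt k kE); first exact/vanishes_modp/vanishes_class_poly3.
  by rewrite -size_class_poly3 ltn_modp.
have := Pdiv.Idomain.divp_eq h class_poly3; rewrite mod0 addr0 lead_coef_class_poly3.
move: (scalp _ _) (_ %/ _) => n Q.
(* The power of the leading coefficient splits into powers of four linear factors, cancelled in
   turn, and of the invertible scalar 1440. *)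
rewrite exprMn mulrC (quarticXY_slopes k) // !exprMn -!scalerA.
have cancel x f Q' : quartic 1 x = 0 -> ('X - (x *: 'X)%:P) ^+ n *: f = Q' * class_poly3 ->
    exists Q'', f = Q'' * class_poly3.
  move=> xE /cancel_linear_exp; apply.
  by rewrite red_class_poly3 // polyC_eq0 red_class_poly3_neq0.
case/(cancel _ _ _ kE) => ? /(cancel _ _ _ kNE)[? /(cancel _ _ _ kVE)[? /(cancel _ _ _ kNVE)[P]]].
move=> hE; exists ((1440^-1 ^+ n)%:P%:P *: P).
rewrite -scalerAl -hE scalerA -!polyC_natr -!polyC_exp -!polyCM -exprMn.
by rewrite mulVf ?pnatr_eq0 // expr1n scale1r.
Qed.

End ClassPolynomialIdeal.

(** * Transfer to [{mpoly R[3]}], total degree and irreducibility *)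

Section TangentialEquation.
Local Open Scope ring_scope.
Context {R : realType}.
Implicit Types (g h : {mpoly R[3]}) (f : {poly {poly {poly R}}}) (u v : R).

(** This direction is a plain function following the monomial expansion; the way back,
    [poly3_to_mpoly3], is a ring morphism and carries divisibility over. *)
Definition mpoly3_to_poly3 g : {poly {poly {poly R}}} :=
  \sum_(m <- msupp g)
    (g@_m)%:P%:P%:P * \prod_(i < 3) [:: 'X%:P%:P; 'X%:P; 'X]`_i ^+ m i.

Lemma rmorph_mpoly3_to_poly3 {T : comNzRingType}
    (F : {rmorphism {poly {poly {poly R}}} -> T}) g :
  F (mpoly3_to_poly3 g) = \sum_(m <- msupp g)
    F (g@_m)%:P%:P%:P * \prod_(i < 3) F [:: 'X%:P%:P; 'X%:P; 'X]`_i ^+ m i.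
Proof.
rewrite rmorph_sum; apply: eq_bigr => m _; rewrite rmorphM rmorph_prod.
by congr (_ * _); apply: eq_bigr => i _; rewrite rmorphXn.
Qed.

Lemma eval3_mpoly3_to_poly3 g (a b c : R) :
  eval3 (mpoly3_to_poly3 g) a b c = g.@[fun j => [:: a; b; c]`_j].
Proof.
rewrite -[LHS]/((horner_eval a \o horner_eval b%:P \o horner_eval c%:P%:P) _).
rewrite rmorph_mpoly3_to_poly3 mevalE; apply: eq_bigr => m _.
rewrite /= /horner_eval !hornerC; congr (_ * _); apply: eq_bigr => i _.
congr (_ ^+ _); case: i => [[|[|[|i]]]] //= _; by rewrite !(hornerC, hornerX).
Qed.

Definition poly1_to_mpoly3 : {rmorphism {poly R} -> {mpoly R[3]}} :=
  horner_morph (fun c => mulrC 'X_(inord 0) (@mpolyC 3 R c)).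
Definition poly2_to_mpoly3 : {rmorphism {poly {poly R}} -> {mpoly R[3]}} :=
  horner_morph (fun p => mulrC 'X_(inord 1) (poly1_to_mpoly3 p)).
Definition poly3_to_mpoly3 : {rmorphism {poly {poly {poly R}}} -> {mpoly R[3]}} :=
  horner_morph (fun p => mulrC 'X_(inord 2) (poly2_to_mpoly3 p)).

Lemma poly3_to_mpoly3C c : poly3_to_mpoly3 c%:P%:P%:P = c%:MP.
Proof. by do 3![rewrite /= horner_morphC]. Qed.

Lemma poly3_to_mpoly3X (i : 'I_3) :
  poly3_to_mpoly3 [:: 'X%:P%:P; 'X%:P; 'X]`_i = 'X_i.
Proof.
rewrite -[in RHS](inord_val i); case: i => [[|[|[|i]]]] //= _;
by do 3?[rewrite /= (horner_morphC, horner_morphX)].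
Qed.

Lemma mpoly3_to_poly3K : cancel mpoly3_to_poly3 poly3_to_mpoly3.
Proof.
move=> g; rewrite [in RHS](mpolyE g) rmorph_mpoly3_to_poly3.
apply: eq_bigr => m _; rewrite poly3_to_mpoly3C mul_mpolyC mpolyXE_id.
by congr (_ *: _); apply: eq_bigr => i _; rewrite poly3_to_mpoly3X.
Qed.

Definition mclass_poly : {mpoly R[3]} :=
  class_poly 'X_(inord 0) 'X_(inord 1) 'X_(inord 2).

Lemma poly3_to_mpoly3_class_poly : poly3_to_mpoly3 class_poly3 = mclass_poly.
Proof.
rewrite /class_poly3 rmorph_class_poly.
have XE (k : nat) (k3 : (k < 3)%N) := poly3_to_mpoly3X (inord k).
have := (XE 0%N isT, XE 1%N isT, XE 2%N isT).
by rewrite !inordK //= => E; rewrite !E.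
Qed.

Lemma meval_mclass_poly (a b c : R) :
  mclass_poly.@[fun j => [:: a; b; c]`_j] = class_poly a b c.
Proof.
by rewrite /mclass_poly rmorph_class_poly /= !mevalXU !inordK.
Qed.

Lemma sumsq1_neq0 u v : u ^+ 2 + v ^+ 2 + 1 != 0.
Proof. by rewrite gt_eqF // ltr_wpDl // addr_ge0 ?sqr_ge0. Qed.

Lemma tangent_offset_bour4 u v :
  tangent_offset (@bour4 R) (@bour4_gauss R) u v =
  - denom u v / (30 * (u ^+ 2 + v ^+ 2 + 1)).
Proof.
rewrite /tangent_offset /dotv !big_ord_recl big_ord0 !mxE /= /denom /quartic.
by field; apply: sumsq1_neq0.
Qed.

Lemma tangent_offset_bour4_eq0 u v :
  (tangent_offset (@bour4 R) (@bour4_gauss R) u v == 0) = (denom u v == 0).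
Proof.
have s30 : 30 * (u ^+ 2 + v ^+ 2 + 1) != 0.
  by rewrite mulf_neq0 ?sumsq1_neq0 // pnatr_eq0.
by rewrite tangent_offset_bour4 mulf_eq0 oppr_eq0 invr_eq0 (negPf s30) orbF.
Qed.

Lemma meval_tangential_coords_bour4 g u v : denom u v != 0 ->
  let q := - 60 / denom u v in
  g.@[fun j => tangential_coords (@bour4 R) (@bour4_gauss R) u v 0 j] =
  eval3 (mpoly3_to_poly3 g) (q * u) (q * v) (q * ((u ^+ 2 + v ^+ 2 - 1) / 2)).
Proof.
move=> d0 q; rewrite eval3_mpoly3_to_poly3; apply: meval_eq => j.
have s0 := sumsq1_neq0 u v.
rewrite mxE tangent_offset_bour4 !mxE /q.
by case: j => [[|[|[|j]]]] //= _; field; rewrite d0 s0.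
Qed.

Lemma vanishesP g : vanishes (mpoly3_to_poly3 g) <->
  (forall u v, tangent_offset (@bour4 R) (@bour4_gauss R) u v != 0 ->
    g.@[fun j => tangential_coords (@bour4 R) (@bour4_gauss R) u v 0 j] = 0).
Proof.
split=> vg u v; last first.
  by move=> d0 /=; rewrite -meval_tangential_coords_bour4 // vg // tangent_offset_bour4_eq0.
rewrite tangent_offset_bour4_eq0 => d0.
by rewrite meval_tangential_coords_bour4 //; apply: vg.
Qed.

Lemma vanishes_mclass_poly : vanishes (mpoly3_to_poly3 mclass_poly).
Proof.
move=> u v d0 /=; rewrite eval3_mpoly3_to_poly3 meval_mclass_poly.
exact: class_poly_coords.
Qed.

Lemma vanishes_mdvd h : vanishes (mpoly3_to_poly3 h) ->
  exists g, h = g * mclass_poly.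
Proof.
move=> /vanishes_dvd[Q hE]; exists (poly3_to_mpoly3 Q).
by rewrite -poly3_to_mpoly3_class_poly -rmorphM -hE mpoly3_to_poly3K.
Qed.

Lemma msize_dhomog {d : nat} {h} : h \is d.-homog -> h != 0 -> msize h = d.+1.
Proof.
move=> hd h0; rewrite (dhomog_uniq h0 hd (dhomog_msize hd)) prednK //.
by rewrite lt0n msize_poly_eq0.
Qed.

Lemma dhomog_natM (d n : nat) h : h \is d.-homog -> n%:R * h \is d.-homog.
Proof. by move=> hd; rewrite mulr_natl; apply: rpredMn. Qed.

Lemma dhomogXn (i : 'I_3) n : 'X_i ^+ n \is [in R[3], n.-homog].
Proof. by rewrite -[X in X.-homog]mul1n; apply: dhomogMn; rewrite dhomogX /= mdeg1. Qed.

(** The polynomial has homogeneous parts of degrees 8, 9 and 10, the last being nonzero at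
    [(1, 0, 0)]. *)
Lemma msize_mclass_poly : msize mclass_poly = 11%N.
Proof.
rewrite /mclass_poly; set a := 'X_(inord 0); set b := 'X_(inord 1).
set c := 'X_(inord 2).
have hr : a ^+ 2 + b ^+ 2 \is 2.-homog by rewrite rpredD ?dhomogXn.
have hc : c \is 1.-homog by rewrite dhomogX /= mdeg1.
have hC : quartic a b \is 4.-homog.
  rewrite /quartic rpredD ?rpredB ?dhomogXn // -mulrA dhomog_natM //.
  exact: (dhomogM (dhomogXn _ 2) (dhomogXn _ 2)).
pose p8 := 900 * (a ^+ 2 + b ^+ 2) ^+ 4.
pose p9 := quartic a b * (1440 * c ^+ 5 + 2400 * (a ^+ 2 + b ^+ 2) * c ^+ 3
                   + 900 * (a ^+ 2 + b ^+ 2) ^+ 2 * c).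
pose p10 := quartic a b ^+ 2 * (16 * (a ^+ 2 + b ^+ 2) + 15 * c ^+ 2).
have h8 : p8 \is 8.-homog by apply: dhomog_natM; exact: (dhomogMn 4 hr).
have h9 : p9 \is 9.-homog.
  apply: (dhomogM (d := 4) (e := 5)) => //; rewrite !rpredD // -?mulrA dhomog_natM //.
  - exact: dhomogXn.
  - exact: (dhomogM hr (dhomogXn _ 3)).
  - exact: (dhomogM hr (dhomogM hr hc)).
have h10 : p10 \is 10.-homog.
  apply: (dhomogM (d := 8) (e := 2)); first exact: (dhomogMn 2 hC).
  by rewrite !rpredD // dhomog_natM // dhomogXn.
have size_le d (p : {mpoly R[3]}) : p \is d.-homog -> (msize p <= d.+1)%N.
  move=> hp; have [->|p0] := eqVneq p 0; first by rewrite msize0.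
  by rewrite (msize_dhomog hp).
have p10_neq0 : p10 != 0.
  apply/eqP => p0; have := meval0 (fun j : 'I_3 => [:: 1; 0; 0 : R]`_j).
  rewrite -[X in X.@[_]]p0 /p10 rmorphM rmorphXn /= rmorph_quartic /=.
  rewrite !(mevalD, mevalM, rmorphXn, rmorph_nat) /= !mevalXU !inordK //=.
  by rewrite /quartic; lra.
have s89 : (msize (p8 + p9) <= 10)%N.
  by rewrite (leq_trans (msizeD_le _ _)) // geq_max (leq_trans (size_le _ _ h8)) ?size_le.
have s10 := msize_dhomog h10 p10_neq0.
rewrite -[class_poly a b c]/(p8 + p9 - p10).
apply/eqP; rewrite eqn_leq; apply/andP; split.
  rewrite (leq_trans (msizeD_le _ _)) // msizeN s10 geq_max andbT.
  exact: leq_trans s89 _.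
(* As [p10] is [p8 + p9] minus the class polynomial, its size 11 must come from the latter. *)
have := msizeD_le (p8 + p9) (- (p8 + p9 - p10)).
rewrite opprB addrC subrK s10 -opprB msizeN => /leq_trans-/(_ _ (leqnn _)).
by rewrite leq_max ltnNge s89.
Qed.

Lemma mclass_poly_neq0 : mclass_poly != 0.
Proof. by rewrite -msize_poly_eq0 msize_mclass_poly. Qed.

Lemma mpoly_unitE h : h \is a GRing.unit -> exists2 c : R, c != 0 & h = c%:MP.
Proof.
by case/andP => /eqP hE; rewrite unitfE => h0; exists h@_0.
Qed.

(** By primality one factor vanishes on the surface, hence is a multiple of the product, and the
    other is a unit. *)
Lemma mclass_poly_irreducible : irreducible_elt mclass_poly.
Proof.
split; first exact: mclass_poly_neq0.
  apply/negP => /mpoly_unitE[c _ cE]; have := msize_mclass_poly.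
  by rewrite cE msizeC; case: (c != 0).
have unitP g h : mclass_poly = g * h -> vanishes (mpoly3_to_poly3 g) ->
    h \is a GRing.unit.
  move=> gh /vanishes_mdvd[k kE]; apply/unitrP; exists k.
  suff : k * h = 1 by move=> kh; split=> //; rewrite mulrC.
  by apply: (mulfI mclass_poly_neq0); rewrite mulr1 {2}gh kE; ring.
move=> g h gh.
(* Since [vanishes] only sees values, the product of the images can replace the image of the
   product. *)
have : vanishes (mpoly3_to_poly3 g * mpoly3_to_poly3 h).
  move=> u v d0 /=; have /= := vanishes_mclass_poly u v d0.
  by rewrite eval3M !eval3_mpoly3_to_poly3 gh mevalM.
case/vanishes_prime => [/(unitP g h gh)|/(unitP h g)]; first by right.
by rewrite mulrC => /(_ gh); left.
Qed.

End TangentialEquation.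

Theorem mainTheorem4 (R : realType) :
  has_class (@bour4 R) (@bour4_gauss R) 10.
Proof.
exists mclass_poly; split.
- split; first exact: mclass_poly_irreducible.
  exact/vanishesP/vanishes_mclass_poly.
- move=> h [[h0 _ h_irr] /vanishesP/vanishes_mdvd[k hE]].
  (* Irreducibility of [h] makes the cofactor [k] a nonzero constant, as [mclass_poly] is not a
     unit. *)
  have [/mpoly_unitE[c c0 kE]|] := h_irr _ _ hE.
    by exists c => //; rewrite hE kE mul_mpolyC.
  by have [_ /negP] := @mclass_poly_irreducible R.
- by rewrite /total_degree msize_mclass_poly.
Qed.
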